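(* Let $\mathbf A$ be a finite supernilpotent algebra belonging to a congruence modular variety. Then $\mathrm{CSAT}(\mathbf A)$ is solvable in polynomial time.
   Context: Supernilpotency is in the sense of higher commutators (Bulatov, Aichinger–Mudrinski): $\mathbf A$ is $k$-supernilpotent if the $(k+1)$-ary higher commutator $[1_A,\dots,1_A]$ equals $0_A$, and supernilpotent if this holds for some $k$. A circuit over $\mathbf A$ is a directed acyclic graph whose input nodes are labelled by variables or constants from $A$ and whose gates are labelled by fundamental operations of $\mathbf A$; size = size of the graph. $\mathrm{CSAT}(\mathbf A)$: given such a circuit with two output gates $g_1,g_2$, decide whether there is an input tuple $\bar a$ with $g_1(\bar a)=g_2(\bar a)$; running time measured in the circuit size. ''Belongs to a congruence modular variety'' means the variety generated by $\mathbf A$ is congruence modular. *)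

(* Defs.v *)
From mathcomp Require Import all_boot.

Set Implicit Arguments.
Unset Strict Implicit.
Unset Printing Implicit Defensive.

Section Signature.
Variables (F : finType) (ar : F -> nat).

Inductive term (V : Type) : Type :=
| TVar of V
| TApp (f : F) of ('I_(ar f) -> term V).

Fixpoint eval (B : Type) (op : forall f : F, ('I_(ar f) -> B) -> B)
  (V : Type) (env : V -> B) (t : term V) : B :=
  match t with
  | TVar v => env v
  | TApp f args => op f (fun i => eval op env (args i))
  end.

Record algebra := Algebra {
  carrier :> Type;
  aop : forall f : F, ('I_(ar f) -> carrier) -> carrier }.

Definition is_congruence (B : algebra) (th : B -> B -> Prop) : Prop :=
  [/\ (forall x, th x x),
      (forall x y, th x y -> th y x),
      (forall x y z, th x y -> th y z -> th x z) &
      (forall (f : F) (x y : 'I_(ar f) -> B),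
          (forall i, th (x i) (y i)) -> th (aop x) (aop y))].

Definition cg_meet (B : algebra) (a b : B -> B -> Prop) : B -> B -> Prop :=
  fun x y => a x y /\ b x y.

Definition cg_join (B : algebra) (a b : B -> B -> Prop) : B -> B -> Prop :=
  fun x y => forall th : B -> B -> Prop, is_congruence th ->
    (forall u v, a u v -> th u v) -> (forall u v, b u v -> th u v) -> th x y.

Definition con_modular (B : algebra) : Prop :=
  forall a b c : B -> B -> Prop,
    is_congruence a -> is_congruence b -> is_congruence c ->
    (forall x y, a x y -> c x y) ->
    forall x y, cg_meet (cg_join a b) c x y <-> cg_join a (cg_meet b c) x y.

Definition satisfies_id (B : algebra) (s t : term nat) : Prop :=
  forall env : nat -> B, eval (@aop B) env s = eval (@aop B) env t.

(* V(A) = HSP(A) = Mod(Id(A)) (Birkhoff): B lies in the variety generated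
   by A iff B satisfies every identity satisfied by A. *)
Definition in_variety_gen (A B : algebra) : Prop :=
  forall s t : term nat, satisfies_id A s t -> satisfies_id B s t.

(* A belongs to a congruence modular variety: V(A) is congruence modular *)
Definition congruence_modular_variety (A : algebra) : Prop :=
  forall B : algebra, in_variety_gen A B -> con_modular B.

Definition sel (k : nat) (s : 'I_k -> bool) (e : bool) (i : 'I_k.+1) : bool :=
  match unlift ord_max i with
  | Some j => s j
  | None => e
  end.

(* alpha_0, ..., alpha_(k-1) centralize alpha_k modulo delta
   (k+1 congruences, indexed by 'I_k.+1; polynomials = terms whose
   variables are either the coordinates x_(i,j), j < m i, or constants). *)
Definition centralizes (B : algebra) (k : nat)
    (alpha : 'I_k.+1 -> B -> B -> Prop) (delta : B -> B -> Prop) : Prop :=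
  forall (m : 'I_k.+1 -> nat)
         (p : term ({i : 'I_k.+1 & 'I_(m i)} + B))
         (a b : forall i : 'I_k.+1, 'I_(m i) -> B),
    (forall i j, alpha i (a i j) (b i j)) ->
    let pe (s : 'I_k -> bool) (e : bool) : B :=
      eval (@aop B)
        (fun v => match v with
                  | inl x => (if sel s e (tag x) then b else a) (tag x) (tagged x)
                  | inr c => c
                  end) p in
    (forall s : 'I_k -> bool, ~ (forall j, s j) ->
        delta (pe s false) (pe s true)) ->
    delta (pe (fun _ => true) false) (pe (fun _ => true) true).

Definition hcomm (B : algebra) (k : nat) (alpha : 'I_k.+1 -> B -> B -> Prop)
  : B -> B -> Prop :=
  fun x y => forall delta, is_congruence delta -> centralizes alpha delta ->
                           delta x y.

Definition k_supernilpotent (B : algebra) (k : nat) : Prop :=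
  forall x y : B, @hcomm B k (fun _ _ _ => True) x y <-> x = y.

Definition supernilpotent (B : algebra) : Prop :=
  exists k, 0 < k /\ k_supernilpotent B k.

End Signature.

(* single-tape deterministic TM with input alphabet S; the tape alphabet
   contains (an injective copy of) S plus the blank (tm_inp None).
   Moves: 0 = left, 1 = stay, 2 = right. *)
Record TM (S : finType) := MkTM {
  tm_state : finType;
  tm_tape : finType;
  tm_inp : option S -> tm_tape;
  tm_inp_inj : injective tm_inp;
  tm_start : tm_state;
  tm_acc : tm_state;
  tm_rej : tm_state;
  tm_delta : tm_state -> tm_tape -> tm_state * tm_tape * 'I_3 }.
Arguments tm_inp {S} t _.
Arguments tm_start {S} t.
Arguments tm_acc {S} t.
Arguments tm_rej {S} t.
Arguments tm_delta {S} t _ _.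

Section TMrun.
Variables (S : finType) (M : TM S).

(* configuration: state, tape left of head (nearest first), head, right *)
Definition config := (tm_state M * seq (tm_tape M) * tm_tape M * seq (tm_tape M))%type.

Definition blank : tm_tape M := tm_inp M None.

Definition tm_step (c : config) : config :=
  let: (q, l, h, r) := c in
  if (q == tm_acc M) || (q == tm_rej M) then c else
  let: (q', h', mv) := tm_delta M q h in
  match val mv with
  | 0 => match l with
         | [::] => (q', [::], blank, h' :: r)
         | x :: l' => (q', l', x, h' :: r)
         end
  | 1 => (q', l, h', r)
  | _ => match r with
         | [::] => (q', h' :: l, blank, [::])
         | x :: r' => (q', h' :: l, x, r')
         end
  end.

Definition tm_init (w : seq S) : config :=
  match [seq tm_inp M (Some x) | x <- w] with
  | [::] => (tm_start M, [::], blank, [::])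
  | x :: r => (tm_start M, [::], x, r)
  end.

Definition tm_run (w : seq S) (t : nat) : config := iter t tm_step (tm_init w).

Definition cfg_state (c : config) : tm_state M := let: (q, _, _, _) := c in q.

End TMrun.

Definition decidable_in_P (S : finType) (L : seq S -> Prop) : Prop :=
  exists (M : TM S) (d : nat), forall w : seq S,
    let q := cfg_state (tm_run M w (size w ^ d + d)) in
    (q = tm_acc M \/ q = tm_rej M) /\ (q = tm_acc M <-> L w).

Section Circuits.
Variables (F : finType) (ar : F -> nat) (T : finType)
          (ops : forall f : F, ('I_(ar f) -> T) -> T).

(* a node of the DAG, listed in topological order: an input node labelled
   by a variable or a constant, or a gate labelled by a fundamental
   operation whose inputs are (indices of) earlier nodes *)
Inductive gate :=
| GVar of nat
| GConst of T
| GOp (f : F) of ('I_(ar f) -> nat).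

Record circuit := Circuit { gates : seq gate; out1 : nat; out2 : nat }.

Definition gate_wf (n : nat) (g : gate) : bool :=
  match g with
  | GOp f args => [forall j, args j < n]
  | _ => true
  end.

Definition circuit_wf (c : circuit) : bool :=
  [forall n : 'I_(size (gates c)), gate_wf n (nth (GVar 0) (gates c) n)]
  && (out1 c < size (gates c)) && (out2 c < size (gates c)).

Definition gate_val (env : nat -> T) (vals : seq T) (g : gate) : T :=
  match g with
  | GVar x => env x
  | GConst a => a
  | GOp f args => ops (fun j => nth (env 0) vals (args j))
  end.

Definition node_vals (env : nat -> T) (c : circuit) : seq T :=
  foldl (fun vals g => rcons vals (gate_val env vals g)) [::] (gates c).

Definition csat_yes (c : circuit) : Prop :=
  exists env : nat -> T,
    nth (env 0) (node_vals env c) (out1 c) = nth (env 0) (node_vals env c) (out2 c).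

(* encoding of circuits as words over a finite alphabet
   (numbers, i.e. node indices and variable names, in unary) *)
Definition sym : finType := (T + F + 'I_4)%type.
Definition s_sep : sym := inr (@Ordinal 4 0 isT).
Definition s_one : sym := inr (@Ordinal 4 1 isT).
Definition s_var : sym := inr (@Ordinal 4 2 isT).
Definition s_out : sym := inr (@Ordinal 4 3 isT).
Definition s_const (a : T) : sym := inl (inl a).
Definition s_op (f : F) : sym := inl (inr f).

Definition enc_nat (n : nat) : seq sym := rcons (nseq n s_one) s_sep.

Definition enc_gate (g : gate) : seq sym :=
  match g with
  | GVar n => s_var :: enc_nat n
  | GConst a => [:: s_const a]
  | GOp f args => s_op f :: flatten [seq enc_nat (args j) | j <- enum 'I_(ar f)]
  end.

Definition enc_circuit (c : circuit) : seq sym :=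
  flatten (map enc_gate (gates c)) ++ s_out :: enc_nat (out1 c) ++ enc_nat (out2 c).

Definition csat_lang (w : seq sym) : Prop :=
  exists c : circuit, circuit_wf c /\ enc_circuit c = w /\ csat_yes c.

Definition CSAT_in_P : Prop := decidable_in_P csat_lang.

End Circuits.

(* Main.v *)
(** A finite supernilpotent algebra satisfies the (k+1)-ary term condition for
    equality: if a polynomial takes equal values along the last direction of a
    (k+1)-dimensional cube everywhere except possibly on the top edge, it does so
    on the top edge as well. Let a solution of [g1 = g2] have many coordinates
    different from a fixed element [z], and colour a set of such coordinates by
    the values of [g1] and [g2] after these coordinates are reset to [z]. Repeated
    use of the pigeonhole principle yields disjoint blocks [J_1, ..., J_k, D], with
    [D] nonempty, such that adding [D] to any nonempty union of the [J_i] does not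
    change the colour. The term condition extends this to the empty union, so
    resetting [D] preserves both values. Hence a solvable equation has a solution
    with at most [N] coordinates different from [z], where [N] depends only on the
    algebra, and it suffices to evaluate the circuit at polynomially many inputs.

    Polynomial time is obtained from machines that repeatedly sweep a finite
    automaton with output from left to right over a tape of fixed length. One
    symbol of the encoding per sweep suffices to evaluate a circuit, and the
    search for a sparse solution is an iterated search over alterations of a
    single cell. *)

From HB Require Import structures.
From Stdlib Require Import FunctionalExtensionality.
Require Import Defs.
From mathcomp Require Import all_boot zify.

Set Implicit Arguments.
Unset Strict Implicit.
Unset Printing Implicit Defensive.

(** * Sweeping machines *)

Record sweeper (X : Type) := Sweeper {
  sw_state : finType;
  sw_cell : finType;
  sw_init : X -> sw_cell;
  sw_start : sw_state;
  sw_delta : sw_state -> sw_cell -> sw_state * sw_cell;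
  sw_fin : sw_state -> sw_state + bool }.
Arguments sw_init {X} s _.
Arguments sw_start {X} s.
Arguments sw_delta {X} s _ _.
Arguments sw_fin {X} s _.

Section SweepRun.
Variables (X : Type) (M : sweeper X).

Fixpoint sweep (q : sw_state M) (s : seq (sw_cell M)) :=
  if s is x :: s' then
    let: (q1, x1) := sw_delta M q x in
    let: (q2, s2) := sweep q1 s' in (q2, x1 :: s2)
  else (q, [::]).

Fixpoint sw_run (t : nat) (q : sw_state M) (s : seq (sw_cell M)) : option bool :=
  if t is t'.+1 then
    let: (q1, s1) := sweep q s in
    match sw_fin M q1 with
    | inl q2 => sw_run t' q2 s1
    | inr b => Some b
    end
  else None.

Lemma size_sweep q s : size (sweep q s).2 = size s.
Proof.
elim: s q => //= x s IH q; case: sw_delta => q1 x1.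
by case E: sweep (IH q1) => [q2 s2] /= ->.
Qed.

Lemma sw_run_leq t t' q s b :
  t <= t' -> sw_run t q s = Some b -> sw_run t' q s = Some b.
Proof.
elim: t t' q s => [|t IH] [|t'] q s //=; rewrite ltnS => le_tt'.
by case: sweep => q1 s1; case: sw_fin => // q2; apply: IH.
Qed.

Lemma sweep_mkseq (st : nat -> sw_state M) (c c' : nat -> sw_cell M) n :
  (forall i, i < n -> sw_delta M (st i) (c i) = (st i.+1, c' i)) ->
  sweep (st 0) (mkseq c n) = (st n, mkseq c' n).
Proof.
elim: n st c c' => //= n IH st c c' Hst.
rewrite Hst // /mkseq /= -[in iota 1 n](addn0 1) !iotaDl -!map_comp.
by rewrite -/(mkseq _ n) (IH (fun i => st i.+1) (c \o addn 1) (c' \o addn 1)) // => i ?; apply: Hst.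
Qed.

End SweepRun.

(** The base [(size w).+2] is at least 2, so that constant factors and lower-order terms can be
    absorbed by raising the exponent. *)
Definition sweep_decidable (X : Type) (L : seq X -> Prop) :=
  exists (M : sweeper X) (k : nat), forall w, exists2 b,
    sw_run ((size w).+2 ^ k) (sw_start M) (map (sw_init M) w) = Some b & (b <-> L w).

(** * Simulation of sweeps by a single-tape Turing machine *)

Section SweepTM.
Variables (S : finType) (M : sweeper S).

Definition tape_cell (h : option S + sw_cell M) : option (sw_cell M) :=
  match h with
  | inl o => omap (sw_init M) o
  | inr c => Some c
  end.

(* [inl (true, q)]: sweeping right in state [q]; [inl (false, q)]: moving back
   to the left end, to start the next sweep in state [q]; [inr b]: halted. *)
Definition sweep_tm_delta (st : bool * sw_state M + bool) (h : option S + sw_cell M)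
    : (bool * sw_state M + bool) * (option S + sw_cell M) * 'I_3 :=
  match st, tape_cell h with
  | inl (true, q), Some c =>
      let: (q', c') := sw_delta M q c in (inl (true, q'), inr c', @Ordinal 3 2 isT)
  | inl (true, q), None =>
      match sw_fin M q with
      | inl q' => (inl (false, q'), h, @Ordinal 3 0 isT)
      | inr b => (inr b, h, @Ordinal 3 1 isT)
      end
  | inl (false, q), Some _ => (inl (false, q), h, @Ordinal 3 0 isT)
  | inl (false, q), None => (inl (true, q), h, @Ordinal 3 2 isT)
  | inr b, _ => (inr b, h, @Ordinal 3 1 isT)
  end.

Lemma inl_inj_tape : injective (@inl (option S) (sw_cell M)).
Proof. by move=> x y []. Qed.

Definition sweep_tm : TM S :=
  @MkTM S (bool * sw_state M + bool)%type (option S + sw_cell M)%type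
    (@inl _ _) inl_inj_tape (inl (true, sw_start M)) (inr true) (inr false)
    sweep_tm_delta.

Local Notation tape := (tm_tape sweep_tm).
Local Notation state := (tm_state sweep_tm).
Local Notation step := (@tm_step S sweep_tm).
Local Notation bl := (blank sweep_tm).

Definition head_right (q : state) (l r : seq tape) : config sweep_tm :=
  if r is x :: r' then (q, l, x, r') else (q, l, bl, [::]).
Definition head_left (q : state) (l r : seq tape) : config sweep_tm :=
  if l is x :: l' then (q, l', x, r) else (q, [::], bl, r).

(** Turning round at an end of the tape leaves at most one explicit blank there. *)
Definition blanks (s : seq tape) := s = [::] \/ s = [:: bl].

Lemma sweep_tm_right q (hs : seq tape) (s : seq (sw_cell M)) l r :
    map tape_cell hs = map Some s ->
  iter (size s) step (head_right (inl (true, q)) l (hs ++ r)) =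
  head_right (inl (true, (sweep q s).1)) (rev (map inr (sweep q s).2) ++ l) r.
Proof.
elim: s hs q l => [|c s IH] [|h hs] q l //= [hc Hhs].
rewrite -iterS iterSr /= hc; case: sw_delta => q1 c1 /=.
rewrite -/(head_right (inl (true, q1)) (inr c1 :: l) (hs ++ r)) IH //.
by case: sweep => q2 s2 /=; rewrite rev_cons cat_rcons.
Qed.

Lemma sweep_tm_left q (s : seq (sw_cell M)) l r :
  iter (size s) step (head_left (inl (false, q)) (map inr s ++ l) r) =
  head_left (inl (false, q)) l (rev (map inr s) ++ r).
Proof.
elim: s r => [|c s IH] r //=.
rewrite -iterS iterSr /= -/(head_left (inl (false, q)) (map inr s ++ l) (inr c :: r)).
by rewrite IH rev_cons cat_rcons.
Qed.

Lemma sweep_tm_round q hs s l r q2 :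
    map tape_cell hs = map Some s -> blanks l -> blanks r ->
    sw_fin M (sweep q s).1 = inl q2 ->
  iter (size s).*2.+2 step (head_right (inl (true, q)) l (hs ++ r)) =
  head_right (inl (true, q2)) [:: bl] (map inr (sweep q s).2 ++ [:: bl]).
Proof.
move=> Hhs Hl Hr Hq2.
(* [size s] moves to the right and one step on the blank ending the sweep, then [size s] moves back
   and one step on the left blank. *)
have -> : (size s).*2.+2 = (1 + size s) + (1 + size s) by lia.
rewrite !iterD sweep_tm_right //.
set L := rev _ ++ l.
have -> : iter 1 step (head_right (inl (true, (sweep q s).1)) L r) =
    head_left (inl (false, q2)) L [:: bl].
  by case: Hr => -> /=; rewrite Hq2; case: (L).
rewrite -{1}(size_sweep q s) /L -map_rev -(size_rev (sweep q s).2) sweep_tm_left.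
rewrite -map_rev revK /=.
by case: Hl => -> /=; case: (map _ _ ++ _).
Qed.

Lemma sweep_tm_halt q hs s l r b :
    map tape_cell hs = map Some s -> blanks r ->
    sw_fin M (sweep q s).1 = inr b ->
  cfg_state (iter (size s).+1 step (head_right (inl (true, q)) l (hs ++ r))) = inr b.
Proof.
move=> Hhs Hr Hb; rewrite -add1n iterD sweep_tm_right //.
by case: Hr => -> /=; rewrite Hb.
Qed.

Lemma sweep_tm_run t q hs s l r b :
    map tape_cell hs = map Some s -> blanks l -> blanks r ->
    sw_run t q s = Some b ->
  exists2 T, T <= t * (size s).*2.+2 &
    cfg_state (iter T step (head_right (inl (true, q)) l (hs ++ r))) = inr b.
Proof.
elim: t q hs s l r => //= t IH q hs s l r Hhs Hl Hr.
case E: sweep => [q1 s1]; case Ef: sw_fin => [q2|b'] Hrun.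
- have Es : size s1 = size s by rewrite -(size_sweep q s) E.
  have [] := IH q2 (map inr s1) s1 [:: bl] [:: bl] _ _ _ Hrun; rewrite -?map_comp //;
    try by right.
  move=> T leT HT; exists (T + (size s).*2.+2); first by lia.
  by rewrite iterD (@sweep_tm_round _ _ _ _ _ q2) // E.
- exists (size s).+1; first by lia.
  by case: Hrun => <-; apply: sweep_tm_halt => //; rewrite E.
Qed.

Lemma sweep_tm_stop T T' (c : config sweep_tm) b :
  T <= T' -> cfg_state (iter T step c) = inr b -> cfg_state (iter T' step c) = inr b.
Proof.
move=> /subnKC <-; rewrite addnC iterD.
elim: (_ - _) => // m IH /IH /=.
by case: (iter m _ _) => [[[q l] h] r] /= ->; case: b {IH}.
Qed.

End SweepTM.

(** Brings a sweep bound into the form [n ^ d + d]: [n + 2 <= n ^ 2] for [n >= 2], and the summand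
    [3 ^ k] covers [n = 0] and [n = 1]. *)
Lemma expn_shift_bound k n : n.+2 ^ k <= n ^ (k.*2 + 3 ^ k) + (k.*2 + 3 ^ k).
Proof.
have pos3 : 0 < 3 ^ k by rewrite expn_gt0.
case: n => [|[|n]].
- rewrite exp0n ?add0n; last by lia.
  by apply: leq_trans (leq_addl _ _); case: (k) => // k'; rewrite leq_exp2r.
- by rewrite exp1n; lia.
- apply: (@leq_trans (n.+2 ^ k.*2)); last first.
    by apply: leq_trans (leq_addr _ _); rewrite leq_exp2l // leq_addr.
  rewrite -mul2n expnM; have : n.+4 <= n.+2 ^ 2 by rewrite -mulnn; nia.
  by case: k {pos3} => // k ?; rewrite leq_exp2r.
Qed.

Lemma sweep_decidable_in_P (S : finType) (L : seq S -> Prop) :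
  sweep_decidable L -> decidable_in_P L.
Proof.
(* Two more factors [n + 2] pay for the [2n + 2] machine steps of each sweep. *)
move=> [M [k HM]]; exists (sweep_tm M), ((k + 2).*2 + 3 ^ (k + 2)) => w.
have [b Hb HL] := HM w.
have Hhs : map (@tape_cell S M) (map inl (map Some w)) = map Some (map (sw_init M) w).
  by rewrite -!map_comp; apply: eq_map.
have bl0 : @blanks S M [::] by left.
have [T leT HT] := sweep_tm_run Hhs bl0 bl0 Hb.
set N := size w ^ _ + _.
have leN : T <= N.
  apply: leq_trans leT _; apply: leq_trans (expn_shift_bound _ _).
  rewrite size_map expnD; apply: leq_mul => //; rewrite -mulnn; nia.
have {HT} := sweep_tm_stop leN HT; rewrite cats0 -map_comp.
have -> : head_right (M := M) (inl (true, sw_start M)) [::] [seq (inl \o Some) i | i <- w] =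
    tm_init (sweep_tm M) w by rewrite /tm_init; case: (w).
rewrite /= /tm_run => ->; split; first by case: (b); [left|right].
by rewrite -HL; case: (b); split=> // [[]].
Qed.

Lemma sweep_decidable_map (X Y : Type) (g : Y -> X) (L : seq X -> Prop) :
  sweep_decidable L -> sweep_decidable (fun w => L (map g w)).
Proof.
move=> [M [k HM]].
exists (@Sweeper Y _ _ (sw_init M \o g) (sw_start M) (sw_delta M) (sw_fin M)), k => w.
have [b Hb HL] := HM (map g w); exists b => //.
by move: Hb; rewrite size_map -map_comp; elim: (_ ^ k) (sw_start M) (map _ w).
Qed.

(** * Search over alterations of a single cell *)

Fixpoint alter_from (X : Type) (f : X -> X) (k p : nat) (w : seq X) : seq X :=
  if w is x :: w' then (if k == p then f x else x) :: alter_from f k.+1 p w' else [::].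

Definition alter (X : Type) (f : X -> X) := alter_from f 0.

Lemma size_alter (X : Type) (f : X -> X) p w : size (alter f p w) = size w.
Proof. by rewrite /alter; elim: w 0 => //= x w IH k; rewrite IH. Qed.

Lemma alter_default (X : Type) (f : X -> X) p w : size w <= p -> alter f p w = w.
Proof.
rewrite /alter -[size w]add0n; elim: w 0 => //= x w IH k le_p.
by rewrite ltn_eqF ?IH //; lia.
Qed.

Lemma nth_alter (X : Type) (f : X -> X) p w x0 i :
  i < size w -> nth x0 (alter f p w) i = if i == p then f (nth x0 w i) else nth x0 w i.
Proof.
rewrite /alter -[i == p]/(0 + i == p); elim: w 0 i => //= x w IH k [|i] lt_i; first by rewrite addn0.
by rewrite /= IH // addSnnS.
Qed.

(** A position past the end alters nothing, so the closure contains [L]. *)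
Definition alter_closure (X : Type) (f : X -> X) (L : seq X -> Prop) (w : seq X) :=
  exists p, L (alter f p w).

Section AlterClosure.
Variables (X : finType) (f : X -> X) (M : sweeper X).

(* [inl (c, q)]: simulating [M] in state [q] on the third component of the
   cells, [c] telling whether the altered position is already marked (by the
   second component); [inr c]: moving the mark one cell to the right, [c] being
   the mark carried over, and restarting the simulation. *)
Definition ac_delta (st : bool * sw_state M + bool) (h : X * bool * sw_cell M)
    : (bool * sw_state M + bool) * (X * bool * sw_cell M) :=
  match st with
  | inl (c, q) => let: (q', y) := sw_delta M q h.2 in (inl (c, q'), (h.1, y))
  | inr c => (inr h.1.2, (h.1.1, c, sw_init M (if c then f h.1.1 else h.1.1)))
  end.

Definition ac_fin (st : bool * sw_state M + bool) : (bool * sw_state M + bool) + bool :=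
  match st with
  | inl (c, q) =>
      match sw_fin M q with
      | inl q' => inl (inl (c, q'))
      | inr b => if b then inr true else inl (inr (~~ c))
      end
  | inr c => if c then inr false else inl (inl (true, sw_start M))
  end.

Definition ac_sweeper : sweeper X :=
  Sweeper (fun x => (x, false, sw_init M x)) (inl (false, sw_start M)) ac_delta ac_fin.

Local Notation tape w mk s := (zip (zip w mk) s : seq (sw_cell ac_sweeper)).

Lemma ac_sweep_inner c q (w : seq X) mk (s : seq (sw_cell M)) :
    size mk = size w -> size s = size w ->
  sweep (M := ac_sweeper) (inl (c, q)) (tape w mk s) =
  (inl (c, (sweep q s).1), tape w mk (sweep q s).2).
Proof.
elim: w mk s q => [|x w IH] [|m mk] [|y s] q //= [Hmk] [Hs].
by case: sw_delta => q1 y1 /=; rewrite IH //; case: sweep.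
Qed.

(** The mark sits on the cell [i] with [i.+1 == p], so [p = 0] means that there is none yet; when
    [k = 0], the initial carry then puts it on the first cell. The final carry tells that the mark
    has left the tape. *)
Lemma ac_sweep_advance p k (w : seq X) (s : seq (sw_cell M)) : size s = size w ->
  sweep (M := ac_sweeper) (inr (k == p)) (tape w [seq i.+1 == p | i <- iota k (size w)] s) =
  (inr (k + size w == p),
   tape w [seq i == p | i <- iota k (size w)] (map (sw_init M) (alter_from f k p w))).
Proof.
elim: w k s => [|x w IH] k [|y s] //=; first by rewrite addn0.
by move=> [Hs]; rewrite IH // addSnnS.
Qed.

Lemma ac_run_inner t c q (w : seq X) mk (s : seq (sw_cell M)) b :
    size mk = size w -> size s = size w -> sw_run t q s = Some b ->
  if b then sw_run (M := ac_sweeper) t (inl (c, q)) (tape w mk s) = Some true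
  else exists t1 s1, [/\ t1 <= t, size s1 = size w &
    forall t', sw_run (M := ac_sweeper) (t1 + t') (inl (c, q)) (tape w mk s) =
               sw_run (M := ac_sweeper) t' (inr (~~ c)) (tape w mk s1)].
Proof.
move=> Hmk; elim: t q s => //= t IH q s Hs.
have:= ac_sweep_inner c q Hmk Hs; have:= size_sweep q s.
case: sweep => [q1 s1] /= Hs1 Hsw; rewrite -Hs1 in Hs.
case Ef: sw_fin => [q2|b'].
  move=> /(IH _ _ Hs) {IH}; case: b => [Hrun|[t1 [s2 [le_t Hs2 Hrun]]]].
    by rewrite Hsw /= Ef.
  by exists t1.+1, s2; split=> // t'; rewrite -Hrun addSn /= Hsw /= Ef.
case=> <- {IH}; case: b' Ef => Ef; first by rewrite Hsw /= Ef.
by exists 1, s1; split=> // t'; rewrite /= Hsw /= Ef.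
Qed.

(** Induction on the number [r] of positions still to be tried. Phase 0 runs [M] on [w], phase
    [p'.+1] on [w] altered at [p']; a phase takes at most [t] sweeps and one more to advance the
    mark. *)
Lemma ac_run (L : seq X -> Prop) t (w : seq X) :
    (forall w', size w' = size w -> exists2 b,
       sw_run t (sw_start M) (map (sw_init M) w') = Some b & (b <-> L w')) ->
  forall r p, p + r = size w ->
  exists2 b,
    sw_run (M := ac_sweeper) (r.+1 * t.+1) (inl (0 < p, sw_start M))
      (tape w [seq i.+1 == p | i <- iota 0 (size w)]
         (map (sw_init M) (if p is p'.+1 then alter f p' w else w))) = Some b &
    (b <-> L (if p is p'.+1 then alter f p' w else w) \/
           exists2 p', p <= p' < size w & L (alter f p' w)).
Proof.
move=> HM r p; move Ewp: (if p is _.+1 then _ else _) => wp.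
have Hwp : size wp = size w by rewrite -Ewp; case: (p) => // p'; rewrite size_alter.
have Hmk p' : size [seq i.+1 == p' | i <- iota 0 (size w)] = size w.
  by rewrite size_map size_iota.
elim: r p wp Ewp Hwp => [|r IH] p wp Ewp Hwp Hp;
  have [[] Hb HL] := HM wp Hwp;
  have:= ac_run_inner (0 < p) (Hmk p) _ Hb; rewrite size_map => /(_ Hwp).
- move=> Hrun; exists true; first by apply: sw_run_leq Hrun; lia.
  by split=> // _; left; apply/HL.
- move=> [t1 [s1 [le_t Hs1 Hrun]]]; exists false.
    apply: (@sw_run_leq _ _ (t1 + 1)); first lia.
    rewrite Hrun /= -eqn0Ngt [p == 0]eq_sym ac_sweep_advance //=.
    by have -> : 0 + size w == p by lia.
  by split=> // [[/HL//|[p' ]]]; lia.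
- move=> Hrun; exists true; first by apply: sw_run_leq Hrun; lia.
  by split=> // _; left; apply/HL.
- move=> [t1 [s1 [le_t Hs1 Hrun]]].
  have [||b Hb' HL'] := IH p.+1 (alter f p w) erefl; rewrite ?size_alter //; first by lia.
  exists b.
    apply: (@sw_run_leq _ _ (t1 + (r.+1 * t.+1).+1)); first lia.
    rewrite Hrun /= -eqn0Ngt [p == 0]eq_sym ac_sweep_advance //=.
    have -> : 0 + size w == p = false by lia.
    by rewrite /= -Hb'.
  rewrite HL'; split=> [[Lp|[p' Hp' Lp']]|[/HL//|[p' Hp' Lp']]].
  + by right; exists p => //; lia.
  + by right; exists p' => //; lia.
  + by have [/eqP|ne] := boolP (p' == p); [left; congruence|right; exists p' => //; lia].
Qed.

End AlterClosure.

Lemma sweep_decidable_alter (X : finType) (f : X -> X) (L : seq X -> Prop) :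
  sweep_decidable L -> sweep_decidable (alter_closure f L).
Proof.
move=> [M [k HM]]; exists (ac_sweeper f M), (k + 2) => w.
have [|b Hb HL] := @ac_run X f M L ((size w).+2 ^ k) w _ (size w) 0 (add0n _).
  by move=> w' <-.
exists b.
  apply: sw_run_leq (_ : (size w).+1 * ((size w).+2 ^ k).+1 <= _) _.
    rewrite expnD expnS expn1; have := expn_gt0 (size w).+2 k; nia.
  rewrite -Hb; congr sw_run => /=.
  by elim: w {2}0 {HM Hb HL} => //= x w IH i; congr cons; apply: IH.
rewrite HL; split=> [[Lw|[p _ Lp]]|[p Lp]].
- by exists (size w); rewrite alter_default.
- by exists p.
- by case: (ltnP p (size w)) => Hp; [right; exists p|left; rewrite alter_default in Lp].
Qed.

(** * Evaluating a circuit by sweeps *)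

Section Evaluator.
Variables (F : finType) (ar : F -> nat) (T : finType)
          (ops : forall f : F, ('I_(ar f) -> T) -> T) (z : T).

Local Notation sym := (sym F T).
Local Notation one := (s_one F T).
Local Notation sep := (s_sep F T).

Definition max_arity := \max_f ar f.

(** The argument values already read are kept in a sequence bounded by the largest arity, which
    makes the type of states finite. *)
Inductive pstate :=
| PGate
| PVar
| PArg of F & max_arity.-bseq T
| POut1
| POut2 of T
| PEnd of bool
| PFail.

Definition pstate_code (s : pstate) : 'I_4 + F * max_arity.-bseq T + T + bool :=
  match s with
  | PGate => inl (inl (inl (@Ordinal 4 0 isT)))
  | PVar => inl (inl (inl (@Ordinal 4 1 isT)))
  | POut1 => inl (inl (inl (@Ordinal 4 2 isT)))
  | PFail => inl (inl (inl (@Ordinal 4 3 isT)))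
  | PArg f vs => inl (inl (inr (f, vs)))
  | POut2 v => inl (inr v)
  | PEnd b => inr b
  end.

Definition pstate_decode (c : 'I_4 + F * max_arity.-bseq T + T + bool) : pstate :=
  match c with
  | inl (inl (inl i)) =>
      match val i with 0 => PGate | 1 => PVar | 2 => POut1 | _ => PFail end
  | inl (inl (inr (f, vs))) => PArg f vs
  | inl (inr v) => POut2 v
  | inr b => PEnd b
  end.

Lemma pstate_codeK : cancel pstate_code pstate_decode.
Proof. by case. Qed.

HB.instance Definition _ := Finite.copy pstate (can_type pstate_codeK).

Definition gate_start (x : sym) : pstate * option T :=
  match x with
  | inl (inl a) => (PGate, Some a)
  | inl (inr f) =>
      if ar f == 0 then (PGate, Some (ops (fun _ : 'I_(ar f) => z)))
      else (PArg f [bseq], None)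
  | inr i => match val i with 2 => (PVar, None) | 3 => (POut1, None) | _ => (PFail, None) end
  end.

(* The unary number just read points at the gate value [rv] ([None] if there is
   no such gate yet) and at the variable value [ev]. *)
Definition number_end (s : pstate) (rv : option T) (ev : T) : pstate * option T :=
  match s, rv with
  | PVar, _ => (PGate, Some ev)
  | PArg f vs, Some v =>
      let vs' := rcons vs v in
      if size vs' == ar f then (PGate, Some (ops (fun i : 'I_(ar f) => nth z vs' i)))
      else (PArg f (insub_bseq max_arity vs'), None)
  | POut1, Some v => (POut2 v, None)
  | POut2 u, Some v => (PEnd (u == v), None)
  | _, _ => (PFail, None)
  end.

Definition reads_number (s : pstate) :=
  match s with PVar | PArg _ _ | POut1 | POut2 _ => true | _ => false end.

Definition pstep (s : pstate) (x : sym) (rv : option T) (ev : T) : pstate * option T :=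
  if s is PGate then gate_start x
  else if x == sep then number_end s rv ev
  else if (x == one) && reads_number s then (s, None)
  else (PFail, None).

(** Parser state, values of the completed gates, and length of the current run of [s_one]
    symbols. *)
Definition eval_state := (pstate * seq T * nat)%type.

Definition eval_step (env : nat -> T) (st : eval_state) (x : sym) : eval_state :=
  let: (s, vals, m) := st in
  let: (s', v) := pstep s x (onth vals m) (env m) in
  (s', vals ++ seq_of_opt v, if x == one then m.+1 else 0).

Definition eval_run env := foldl (eval_step env).

Definition accepting (st : eval_state) := if st.1.1 is PEnd b then b else false.

Definition ev_state : finType :=
  (pstate * option sym * option T * option sym * bool * option (option T * T))%type.
Definition ev_cell : finType := (sym * T * option T * bool * bool)%type.

(* Each sweep processes one symbol [cur] of the word. Cell [i] stores the value
   of gate [i] and that of variable [i]; the value [pend] computed by the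
   previous sweep goes to the first cell without gate value. The last two
   components of a cell record whether its symbol was already fetched and
   whether the number being read points at it. *)
Definition ev_delta (q : ev_state) (h : ev_cell) : ev_state * ev_cell :=
  let: (s, cur, pend, nxt, c, rd) := q in
  let: (xe, v, dn, mk) := h in
  let v1 := if v is None then pend else v in
  ((s, cur, if v is None then None else pend,
    if ~~ dn && (nxt == None) then Some xe.1 else nxt,
    (cur == Some one) && mk,
    if mk then Some (v1, xe.2) else rd),
   (xe, v1, dn || (nxt == None), c)).

Definition ev_fin (q : ev_state) : ev_state + bool :=
  let: (s, cur, pend, nxt, c, rd) := q in
  let: (s', v) :=
    if cur is Some x then let: (rv, ev) := odflt (None, z) rd in pstep s x rv ev
    else (s, None) in
  if nxt is None then inr (if s' is PEnd b then b else false)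
  else inl (s', nxt, v, None, nxt != Some one, None).

Definition evaluator : sweeper (sym * T) :=
  @Sweeper _ ev_state ev_cell (fun xe => (xe, None, false, false))
    (PGate, None, None, None, true, None) ev_delta ev_fin.

Section Simulation.
Variables (w : seq (sym * T)) (x0 : sym * T).

Local Notation n := (size w).

Definition ev_tape (vals : seq T) (r m : nat) : seq (sw_cell evaluator) :=
  mkseq (fun i => (nth x0 w i, onth vals i, i < r, i == m) : ev_cell) n.

Lemma ev_sweep s cur tv pend r m (m' := if cur == Some one then m.+1 else 0) :
  sweep (M := evaluator) (s, cur, pend, None, cur != Some one, None) (ev_tape tv r m) =
  ((s, cur, if n <= size tv then pend else None,
    if r < n then Some (nth x0 w r).1 else None, n == m',
    if m < n then Some (onth (tv ++ seq_of_opt pend) m, (nth x0 w m).2) else None),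
   ev_tape (tv ++ seq_of_opt pend) r.+1 m').
Proof.
(* The state in front of cell [i]: the pending value travels up to the first free cell, the next
   symbol is known once cell [r] is passed, and the carry is set exactly in front of the new pointer
   position [m']. *)
pose st i : ev_state := (s, cur, if i <= size tv then pend else None,
    if r < i then Some (nth x0 w r).1 else None, i == m',
    if m < i then Some (onth (tv ++ seq_of_opt pend) m, (nth x0 w m).2) else None).
have -> : (s, cur, pend, None, cur != Some one, None) = st 0.
  by rewrite /st /m'; case: eqP.
rewrite (sweep_mkseq (M := evaluator) (st := st)
  (c' := fun i => (nth x0 w i, onth (tv ++ seq_of_opt pend) i, i < r.+1, i == m'))) //.
move=> i lt_i; rewrite /= /st /ev_delta /m'.
have -> : (if onth tv i is None then if i <= size tv then pend else None else onth tv i) =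
    onth (tv ++ seq_of_opt pend) i.
  rewrite onth_cat; have := onthTE tv i; case: onth => [v|] /= lt_tv; first by rewrite -lt_tv.
  rewrite -lt_tv; case: (ltngtP i (size tv)) lt_tv => //= [|->]; last first.
    by rewrite subnn; case: (pend).
  by move=> lt_tv _; case: (pend) => [v|]; rewrite onth_default //= subn_gt0.
congr (_, _, _, _, _, _, (_, _, _, _)).
- have := onthTE tv i; case: onth => [v|] /= lt_tv; first by rewrite -lt_tv ltnW.
  by case: (ltngtP i (size tv)) lt_tv.
- by rewrite [r < i.+1]ltnS; case: (ltngtP i r) => [||->] //=.
- by case: (cur == Some one).
- by rewrite [m < i.+1]ltnS; case: (ltngtP m i) => [||->] //=.
- by rewrite [i < r.+1]ltnS; case: (ltngtP i r).
Qed.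

Local Notation env := (nth z (map snd w)).
Local Notation accepted st u := (Some (accepting (eval_run env st u))).

(** The pointer advances by at most one cell per symbol read; hence [m <= r], and it stays on the
    tape. *)
Lemma ev_run d r s tv pend m : r + d.+1 = n -> m <= r ->
  sw_run (M := evaluator) d.+1
    (s, Some (nth x0 w r).1, pend, None, Some (nth x0 w r).1 != Some one, None)
    (ev_tape tv r.+1 m) =
  accepted (s, tv ++ seq_of_opt pend, m) (drop r (map fst w)).
Proof.
elim: d r s tv pend m => [|d IH] r s tv pend m Hr le_mr;
  have lt_mn : m < n by [lia]; have lt_rn : r < n by [lia];
  rewrite [LHS]/= ev_sweep /= lt_mn (drop_nth x0.1) ?size_map //=;
  rewrite !(nth_map x0) //; case: pstep => s' v /=.
- have -> : r.+1 < n = false by lia.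
  by rewrite (@drop_oversize _ r.+1) // size_map -Hr addn1.
- have -> : r.+1 < n by lia.
  by apply: (IH r.+1 s'); [lia|case: ifP; lia].
Qed.

(** The extra sweep fetches the first symbol. The pointer position [n] on the initial tape means
    that no cell is marked. *)
Lemma evaluator_run :
  sw_run n.+1 (sw_start evaluator) (map (sw_init evaluator) w) =
  accepted (PGate, [::], 0) (map fst w).
Proof.
have -> : map (sw_init evaluator) w = ev_tape [::] 0 n.
  rewrite -[in LHS](mkseq_nth x0 w) /mkseq -map_comp; apply/eq_in_map => i.
  by rewrite mem_iota /= onth0n add0n => /ltn_eqF ->.
have := ev_sweep PGate None [::] None 0 n; rewrite /= => ->.
case: (posnP n) => [/size0nil -> // |lt0n] /=.
have [d Hd] : exists d, 0 + d.+1 = n by exists n.-1; lia.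
have := ev_run PGate [::] None Hd (leqnn 0); rewrite drop0 => <-.
by congr sw_run; rewrite -Hd.
Qed.

End Simulation.

Lemma evaluator_decidable :
  sweep_decidable (fun w : seq (sym * T) =>
    accepting (eval_run (nth z (map snd w)) (PGate, [::], 0) (map fst w))).
Proof.
exists evaluator, 1 => w; eexists; last by split=> H; exact H.
apply: (@sw_run_leq _ _ (size w).+1); first by rewrite expn1.
exact: (@evaluator_run w (one, z)).
Qed.

End Evaluator.

Lemma insub_bseqK n (T : Type) (s : seq T) : size s <= n -> insub_bseq n s = s :> seq T.
Proof. by move=> le_sn; rewrite /insub_bseq /insubd insubT. Qed.

(** * Correctness of the parser and of the computed gate values *)

Section Parser.
Variables (F : finType) (ar : F -> nat) (T : finType)
          (ops : forall f : F, ('I_(ar f) -> T) -> T) (z : T) (env : nat -> T).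

Local Notation sym := (sym F T).
Local Notation one := (s_one F T).
Local Notation sep := (s_sep F T).
Local Notation gate := (gate ar T).
Local Notation num := (enc_nat F T).
Local Notation code gs := (flatten (map (@enc_gate F ar T) gs)).
Local Notation run := (eval_run ops z env).

Definition gates_wf (gs : seq gate) : Prop :=
  forall n, n < size gs -> gate_wf n (nth (GVar ar T 0) gs n).

Definition gate_vals (gs : seq gate) : seq T :=
  foldl (fun vals g => rcons vals (gate_val ops env vals g)) [::] gs.

Lemma gate_vals_rcons gs g :
  gate_vals (rcons gs g) = rcons (gate_vals gs) (gate_val ops env (gate_vals gs) g).
Proof. exact: foldl_rcons. Qed.

Lemma size_gate_vals gs : size (gate_vals gs) = size gs.
Proof. by elim/last_ind: gs => // gs g IH; rewrite gate_vals_rcons !size_rcons IH. Qed.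

Lemma gates_wf_rcons gs g :
  gates_wf (rcons gs g) <-> gates_wf gs /\ gate_wf (size gs) g.
Proof.
split=> [H|[H Hg] n].
  split=> [n lt_n|]; last by have := H (size gs); rewrite size_rcons nth_rcons ltnn eqxx => ->.
  by have := H n; rewrite size_rcons nth_rcons lt_n => -> //; apply: leqW.
by rewrite size_rcons nth_rcons ltnS; case: ltngtP => // [/H|->].
Qed.

Lemma circuit_wfP (c : circuit ar T) :
  circuit_wf c <-> [/\ gates_wf (gates c), out1 c < size (gates c) & out2 c < size (gates c)].
Proof.
rewrite /circuit_wf; split.
  move=> /andP[/andP[/forallP H ? ?]]; split=> // n lt_n; exact: (H (Ordinal lt_n)).
by move=> [H -> ->]; rewrite !andbT; apply/forallP => n; apply: H.
Qed.

Lemma nth_onth (vals : seq T) k v : onth vals k = Some v -> k < size vals /\ nth z vals k = v.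
Proof.
by move=> Hk; rewrite (@onth_nth _ z _ _ _ Hk); have := onthTE vals k; rewrite Hk => <-.
Qed.

Lemma onth_Some (vals : seq T) k : k < size vals -> onth vals k = Some (nth z vals k).
Proof. by rewrite -onthTE; case E: onth => [v|] // _; rewrite (@onth_nth _ z _ _ _ E). Qed.

Lemma leq_max_arity (f : F) : ar f <= max_arity ar.
Proof. exact: leq_bigmax. Qed.

Lemma map_nth_enum (l : seq nat) k : size l = k -> [seq nth 0 l (nat_of_ord j) | j <- enum 'I_k] = l.
Proof.
move=> Hl; have -> : [seq nth 0 l (nat_of_ord j) | j <- enum 'I_k] = map (nth 0 l) (map val (enum 'I_k)).
  by rewrite -map_comp.
by rewrite val_enum_ord -Hl -/(mkseq _ _) mkseq_nth.
Qed.

(** The part of a circuit recovered from the word [u] read so far. In state [PEnd] it is a whole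
    well-formed circuit with code [u], which gives soundness of acceptance. *)
Definition parse_inv (u : seq sym) (st : eval_state ar T) : Prop :=
  let: (s, vals, m) := st in
  match s with
  | PGate => exists gs, [/\ gates_wf gs, vals = gate_vals gs & u = code gs]
  | PVar => exists gs, [/\ gates_wf gs, vals = gate_vals gs &
                           u = code gs ++ s_var F T :: nseq m one]
  | PArg f vs => exists gs l,
      [/\ gates_wf gs, vals = gate_vals gs, all (ltn^~ (size gs)) l,
          size l < ar f /\ vs = map (nth z vals) l :> seq T &
          u = code gs ++ s_op T f :: flatten (map num l) ++ nseq m one]
  | POut1 => exists gs, [/\ gates_wf gs, vals = gate_vals gs &
                            u = code gs ++ s_out F T :: nseq m one]
  | POut2 v => exists gs o1,
      [/\ gates_wf gs, vals = gate_vals gs, o1 < size gs, v = nth z vals o1 &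
          u = code gs ++ s_out F T :: num o1 ++ nseq m one]
  | PEnd b => exists gs o1 o2,
      [/\ gates_wf gs, o1 < size gs, o2 < size gs,
          b = (nth z (gate_vals gs) o1 == nth z (gate_vals gs) o2) &
          u = code gs ++ s_out F T :: num o1 ++ num o2]
  | PFail => True
  end.

Lemma rcons_nseq_one m : rcons (nseq m one) one = nseq m.+1 one.
Proof. by elim: m => //= m ->. Qed.

Lemma parse_inv_step u st x :
  parse_inv u st -> parse_inv (rcons u x) (eval_step ops z env st x).
Proof.
case: st => [[s vals] m] /=.
case: s => [|||||b|]; rewrite /pstep /=.
- move=> [gs [Hgs -> ->]].
  case: x => [[a|f]|i].
  + exists (rcons gs (GConst ar a)); rewrite gate_vals_rcons cats1; split=> //.
      by apply/gates_wf_rcons.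
    by rewrite map_rcons flatten_rcons cats1.
  + rewrite /gate_start; case: eqP => [ar0|/eqP ar0] /=.
      have no_ord (j : 'I_(ar f)) : False by move: (ltn_ord j); rewrite [X in _ < X]ar0.
      (* A nullary gate has no arguments; the index 0 is a dummy. *)
      exists (rcons gs (GOp T (fun _ : 'I_(ar f) => 0))); rewrite gate_vals_rcons cats1; split=> //.
      * apply/gates_wf_rcons; split=> //=; apply/forallP => j.
        by case: (no_ord j).
      * congr rcons => /=; congr ops; apply: functional_extensionality => j.
        by case: (no_ord j).
      * rewrite map_rcons flatten_rcons /= -cats1; congr (_ ++ _ :: _).
        by case: (enum _) => // j; case: (no_ord j).
    exists gs, [::]; split=> //; rewrite ?cats0 ?cats1 //.
    by rewrite lt0n.
  + case: i => [[|[|[|[|i]]]] lt_i] //=; exists gs; rewrite cats0; split=> //;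
      by rewrite cats1; congr rcons; congr inr; apply: val_inj.
- move=> [gs [Hgs -> ->]]; case: eqP => [->|_] /=.
    exists (rcons gs (GVar ar T m)); rewrite gate_vals_rcons cats1; split=> //.
      by apply/gates_wf_rcons.
    by rewrite map_rcons flatten_rcons rcons_cat.
  case: eqP => [->|] //=; exists gs; split; rewrite ?cats0 //.
  by rewrite rcons_cat rcons_cons rcons_nseq_one.
- move=> f vs [gs [l [Hgs Evals Hl [lt_l Evs] ->]]]; case: eqP => [->|_] /=; last first.
    case: eqP => [->|] //=; exists gs, l; split; rewrite ?cats0 //.
    by rewrite rcons_cat rcons_cons rcons_cat rcons_nseq_one.
  case Em: onth => [v|] //=; have [lt_m Ev] := nth_onth Em.
  rewrite size_rcons Evs size_map.
  have Hl' : all (ltn^~ (size gs)) (rcons l m).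
    by rewrite all_rcons Hl andbT -size_gate_vals -Evals.
  have Evs' : rcons (map (nth z vals) l) v = map (nth z vals) (rcons l m).
    by rewrite map_rcons Ev.
  rewrite Evs'; case: eqP => [El|/eqP ne_l] /=.
    exists (rcons gs (GOp T (fun j : 'I_(ar f) => nth 0 (rcons l m) j))).
    rewrite gate_vals_rcons cats1 Evals; split=> //.
    + apply/gates_wf_rcons; split=> //=; apply/forallP => j.
      by apply: (allP Hl'); rewrite mem_nth // size_rcons El.
    + congr rcons => /=; congr ops; apply: functional_extensionality => j.
      have lt_j : nth 0 (rcons l m) j < size (gate_vals gs).
        by rewrite size_gate_vals; apply: (allP Hl'); rewrite mem_nth // size_rcons El.
      by rewrite (nth_map 0) ?size_rcons ?El //; apply: set_nth_default.
    + rewrite map_rcons flatten_rcons /= rcons_cat rcons_cons.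
      rewrite (map_comp num (fun j : 'I_(ar f) => nth 0 (rcons l m) j)).
      rewrite map_nth_enum ?size_rcons // map_rcons flatten_rcons.
      by rewrite rcons_cat.
  have lt_l' : size (rcons l m) < ar f by rewrite size_rcons ltn_neqAle ne_l.
  exists gs, (rcons l m); rewrite !cats0; split=> //.
    split=> //; rewrite insub_bseqK // size_map.
    exact: leq_trans (ltnW lt_l') (leq_max_arity f).
  by rewrite map_rcons flatten_rcons rcons_cat rcons_cons rcons_cat.
- move=> [gs [Hgs Evals ->]]; case: eqP => [->|_] /=; last first.
    case: eqP => [->|] //=; exists gs; split; rewrite ?cats0 //.
    by rewrite rcons_cat rcons_cons rcons_nseq_one.
  case Em: onth => [v|] //=; have [lt_m Ev] := nth_onth Em.
  exists gs, m; rewrite !cats0 -size_gate_vals -Evals; split=> //.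
  by rewrite rcons_cat rcons_cons.
- move=> v [gs [o1 [Hgs Evals lt_o1 Ev1 ->]]]; case: eqP => [->|_] /=; last first.
    case: eqP => [->|] //=; exists gs, o1; split; rewrite ?cats0 //.
    by rewrite rcons_cat rcons_cons rcons_cat rcons_nseq_one.
  case Em: onth => [v'|] //=; have [lt_m Ev] := nth_onth Em.
  exists gs, o1, m; rewrite -Evals Ev1 Ev; split=> //.
    by rewrite -size_gate_vals -Evals.
  by rewrite rcons_cat rcons_cons rcons_cat.
- by move=> _; case: eqP => //; rewrite andbF.
- by move=> _; case: eqP => //; rewrite andbF.
Qed.

Lemma parse_inv_run u : parse_inv u (run (PGate ar T, [::], 0) u).
Proof.
elim/last_ind: u => [|u x IH]; first by exists [::].
by rewrite /eval_run foldl_rcons; apply: parse_inv_step.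
Qed.

Lemma run_number s vals m k u : reads_number s ->
  run (s, vals, m) (nseq k one ++ u) = run (s, vals, m + k) u.
Proof.
move=> Hs; elim: k m => [|k IH] m; first by rewrite addn0.
rewrite /eval_run /= /pstep Hs /=; case: s Hs IH => //= *;
  by rewrite cats0 -/(eval_run _ _ _ _ _) addnS -addSn.
Qed.

Lemma run_enc_nat s vals k u : reads_number s ->
  run (s, vals, 0) (num k ++ u) =
  let: (s', v) := number_end ops z s (onth vals k) (env k) in
  run (s', vals ++ seq_of_opt v, 0) u.
Proof.
move=> Hs; rewrite /enc_nat cat_rcons run_number // /eval_run /= add0n.
have -> : pstep ops z s sep (onth vals k) (env k) =
          number_end ops z s (onth vals k) (env k) by case: s Hs.
by case: number_end.
Qed.

(** The operation is applied when its last argument arrives, whence [0 < size l]; nullary operations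
    are dealt with by [gate_start]. *)
Lemma run_args f (vs : seq T) vals l u :
    size vs + size l = ar f -> 0 < size l -> all (ltn^~ (size vals)) l ->
  run (PArg f (insub_bseq (max_arity ar) vs), vals, 0) (flatten (map num l) ++ u) =
  run (PGate ar T, rcons vals (ops (fun i : 'I_(ar f) => nth z (vs ++ map (nth z vals) l) i)), 0) u.
Proof.
elim: l vs => //= k l IH vs Hsz _ /andP[lt_k Hl].
rewrite -catA run_enc_nat //= (onth_Some lt_k) insub_bseqK; last first.
  by apply: leq_trans (leq_max_arity f); rewrite -Hsz leq_addr.
rewrite size_rcons; case: eqP => Hsz'.
  have -> : l = [::] by apply: size0nil; lia.
  by rewrite !cats1.
by rewrite cats0 IH //= ?cat_rcons ?size_rcons //; lia.
Qed.

Lemma run_gate g vals m u : gate_wf (size vals) g ->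
  run (PGate ar T, vals, m) (enc_gate g ++ u) =
  run (PGate ar T, rcons vals (gate_val ops env vals g), 0) u.
Proof.
case: g => [x|a|f args] /= Hg.
- transitivity (run (PVar ar T, vals ++ [::], 0) (num x ++ u)) => //.
  by rewrite cats0 run_enc_nat //= cats1.
- by rewrite /eval_run /= cats1.
- pose l := [seq args j | j <- enum 'I_(ar f)].
  have Hl : size l = ar f by rewrite size_map size_enum_ord.
  have Eargs : (fun j : 'I_(ar f) => nth (env 0) vals (args j)) =
               (fun j : 'I_(ar f) => nth z ([::] ++ map (nth z vals) l) j).
    apply: functional_extensionality => j.
    rewrite /= (nth_map 0) ?Hl // (nth_map j) ?size_enum_ord // nth_ord_enum.
    by apply: set_nth_default; apply: (forallP Hg).
  rewrite Eargs (map_comp num args) -/l; have [ar0|ar_gt0] := posnP (ar f).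
    have -> : l = [::] by apply: size0nil; rewrite Hl.
    rewrite /eval_run /= cats1; congr (foldl _ (_, rcons _ (ops _), _)).
    by apply: functional_extensionality => j; rewrite nth_nil.
  rewrite -run_args ?Hl //; first rewrite /eval_run /= cats0.
    by congr (foldl _ (PArg _ _, _, _)); apply: val_inj; rewrite /= insub_bseqK.
  by apply/allP => _ /mapP[j _ ->]; apply: (forallP Hg).
Qed.

Lemma run_gates gs u : gates_wf gs ->
  run (PGate ar T, [::], 0) (code gs ++ u) = run (PGate ar T, gate_vals gs, 0) u.
Proof.
elim/last_ind: gs u => // gs g IH u /gates_wf_rcons[Hgs Hg].
by rewrite map_rcons flatten_rcons -catA IH // run_gate ?size_gate_vals // gate_vals_rcons.
Qed.

Lemma evaluator_accepts u :
  accepting (run (PGate ar T, [::], 0) u) <->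
  exists c : circuit ar T,
    [/\ circuit_wf c, enc_circuit c = u &
        nth z (node_vals ops env c) (out1 c) = nth z (node_vals ops env c) (out2 c)].
Proof.
split.
  have := parse_inv_run u; case: (run _ u) => [[[] //= b] vals m].
  move=> [gs [o1 [o2 [Hgs lt_o1 lt_o2 Eb ->]]]] Hb.
  exists (Circuit gs o1 o2); split=> //; first by apply/circuit_wfP.
  by move: Hb; rewrite Eb => /eqP.
move=> [[gs o1 o2] [/circuit_wfP[/= Hgs lt_o1 lt_o2] <- Eout]].
rewrite /enc_circuit run_gates //=.
rewrite -[run _ _]/(run (POut1 ar T, gate_vals gs ++ [::], 0) (num o1 ++ num o2)).
rewrite cats0 run_enc_nat //= onth_Some ?size_gate_vals //= -[num o2]cats0.
by rewrite run_enc_nat //= cats0 onth_Some ?size_gate_vals //=; apply/eqP.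
Qed.

End Parser.

(** * Sparse solutions *)

Definition local_below (N : nat) (C : Type) (g : (nat -> bool) -> C) :=
  forall P Q : nat -> bool, (forall x, x < N -> P x = Q x) -> g P = g Q.

(* The labelling [phi] describes disjoint subsets of [{0, ..., N - 1}]: the base
   (label 0) and M further nonempty blocks (labels 1 to M). *)
Lemma monochromatic_cube M (C : finType) : exists N,
  forall g : (nat -> bool) -> C, local_below N g -> exists phi : nat -> nat,
    (forall j, 0 < j <= M -> exists2 x, x < N & phi x = j) /\
    (forall P : nat -> bool, P 0 -> (forall j, M < j -> ~~ P j) ->
       g (fun x => P (phi x)) = g (fun x => phi x == 0)).
Proof.
elim: M => [|M [N0 IH]].
  exists 0 => g Hg; exists (fun _ => 0); split=> [j|P P0 _]; first by lia.
  exact: Hg.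
(* As many fresh points as there are colourings of the subsets of the first [N0] points; [gi i] is
   the colouring of these subsets after adding the first [i] fresh points. *)
pose L := #|{ffun {set 'I_N0} -> C}|; exists (N0 + L) => g Hg.
pose gi i (A : nat -> bool) := g (fun x => if x < N0 then A x else x - N0 < i).
have gi_local i : local_below N0 (gi i).
  by move=> P Q PQ; apply: Hg => x _; case: ifP => // /PQ.
pose G (i : 'I_L.+1) := [ffun A : {set 'I_N0} =>
  gi i (fun x => if insub x is Some y then y \in A else false)].
(* Pigeonhole: [L.+1] indices, but only [L] colourings. *)
have [i [i' lt_ii' EG]] : exists i : 'I_L.+1, exists2 i' : 'I_L.+1, i < i' & G i = G i'.
  have /injectivePn[i [i' ne EG]] : ~~ injectiveb G.
    by apply/negP => /injectiveP/leq_card; rewrite card_ord /L ltnn.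
  have [lt|lt|/val_inj/eqP] := ltngtP i i'; last by rewrite (negPf ne).
    by exists i, i'.
  by exists i', i.
have Egi A : gi i A = gi i' A.
  have EA j : gi j A = gi j (fun x => if insub x is Some y then
                               y \in [set y : 'I_N0 | A y] else false).
    by apply: gi_local => x lt_x; rewrite insubT inE.
  by have := congr1 (fun h : {ffun _} => h [set y : 'I_N0 | A y]) EG; rewrite !ffunE -!EA.
have [phi [phi_onto phiP]] := IH (gi i) (gi_local i).
(* The fresh points below [i] join the base, and those from [i] up to [i'] (excluded) form block
   [M.+1]. The label [M.+2] discards a point. *)
pose psi x := if x < N0 then (if phi x <= M then phi x else M.+2)
              else if x - N0 < i then 0 else if x - N0 < i' then M.+1 else M.+2.
exists psi; split=> [j Hj|P P0 PM].
  have [Ej|ne_j] := eqVneq j M.+1.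
    exists (N0 + i); first by have := ltn_ord i'; lia.
    by rewrite /psi addKn ltnn lt_ii' Ej; case: ifP => //; lia.
  have [|x lt_x Ex] := phi_onto j; first by lia.
  by exists x; rewrite ?ltn_addr // /psi lt_x Ex; case: ifP => //; lia.
pose A x := P (phi x) && (phi x <= M).
have PM2 : P M.+2 = false by apply/negbTE/PM.
transitivity (gi (if P M.+1 then i' else i) A).
  apply: Hg => x _; rewrite /A /psi.
  case: ifP => _; first by case: ifP; rewrite ?andbT ?andbF.
  by case PM1: (P M.+1); do 2?[case: ifP => //]; lia.
transitivity (gi i A); first by case: ifP; rewrite ?Egi.
transitivity (gi i (fun x => phi x == 0)).
  by apply: (phiP (fun j => P j && (j <= M))) => [|j]; rewrite ?P0 //; lia.
apply: Hg => x _; rewrite /psi; case: ifP => _; first by case: ifP => //; lia.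
by do 2?[case: ifP => //].
Qed.

(* Among the blocks labelled 0, ..., n, adding block 0 to a union of others does
   not change the colour, as long as this union has at least one member. *)
Lemma invisible_block n (C : finType) : exists N,
  forall g : (nat -> bool) -> C, local_below N g -> exists phi : nat -> nat,
    (exists2 x, x < N & phi x = 0) /\
    (forall P : nat -> bool,
       (exists2 i, 0 < i <= n & P i) -> (forall i, n < i -> ~~ P i) ->
       g (fun x => P (phi x)) = g (fun x => (phi x == 0) || P (phi x))).
Proof.
elim: n => [|n [N0 IH]].
  exists 1 => g _; exists (fun _ => 0); split; first by exists 0.
  by move=> P [i]; lia.
have [N HN] := monochromatic_cube N0 C; exists N => g Hg.
have [phi [phi_onto phiP]] := HN g Hg.
(* The [N0] blocks of the cube are the points to which the induction hypothesis applies; the base is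
   left out here. *)
pose g1 (Q : nat -> bool) := g (fun x => (0 < phi x <= N0) && Q (phi x).-1).
have g1_local : local_below N0 g1.
  move=> P Q PQ; apply: Hg => x _; case E: (0 < phi x <= N0) => //=.
  by apply: PQ; lia.
have [chi [[y lt_y Ey] chiP]] := IH g1 g1_local.
pose cut l := if l <= n then l else n.+2.
(* The base of the cube becomes the new block [n.+1], and [n.+2] discards a point. *)
pose psi x := if phi x == 0 then n.+1 else if phi x <= N0 then cut (chi (phi x).-1) else n.+2.
exists psi; split=> [|P [i Hi Pi] Pn].
  have [|x lt_x Ex] := phi_onto y.+1; first by lia.
  by exists x; rewrite // /psi Ex /= lt_y Ey.
have Pn2 : P n.+2 = false by apply/negbTE/Pn.
(* A union containing the base has the colour of the base, with or without block 0. Otherwise some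
   block among 1 to [n] is present and the induction hypothesis applies. *)
have [Pn1|nPn1] := boolP (P n.+1).
  have base (R : nat -> bool) : R n.+1 -> R n.+2 = false ->
      g (fun x => R (psi x)) = g (fun x => phi x == 0).
    move=> R1 R2.
    rewrite -(phiP (fun j => (j == 0) || (j <= N0) && R (cut (chi j.-1)))) => //; last by lia.
    apply: Hg => x _; rewrite /psi; case: eqP => //= _.
    by case: ifP.
  by rewrite (base P) // (base (fun l => (l == 0) || P l)).
have inner (R : nat -> bool) : R n.+1 = false -> R n.+2 = false ->
    g (fun x => R (psi x)) = g1 (fun y => R (chi y) && (chi y <= n)).
  move=> R1 R2; apply: Hg => x _; rewrite /psi /cut lt0n; case: eqP => //= _.
  by case: ifP => //= _; case: ifP; rewrite ?andbT ?andbF.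
rewrite (inner P) ?(negbTE nPn1) // (inner (fun l => (l == 0) || P l)) ?(negbTE nPn1) //.
rewrite (chiP (fun l => P l && (l <= n))) => [||j lt_j].
- by apply: g1_local => x _; case: eqP => // ->.
- exists i; last by rewrite Pi; have [Ein|] := eqVneq i n.+1; [rewrite Ein in Pi; rewrite Pi in nPn1|lia].
  by have [Ein|] := eqVneq i n.+1; [rewrite Ein in Pi; rewrite Pi in nPn1|lia].
- by rewrite negb_and orbC -ltnNge lt_j.
Qed.

Lemma count_ltn (A : eqType) (a b : pred A) (s : seq A) x :
  subpred a b -> x \in s -> b x -> ~~ a x -> count a s < count b s.
Proof.
move=> ab xs bx nax.
have -> : count b s = count a s + count (predD b a) s.
  rewrite -count_predUI [X in _ + X](eq_count (a2 := pred0)) ?count_pred0 ?addn0.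
    by apply: eq_count => y /=; have := ab y; case: (a y) => //= ->.
  by move=> y /=; case: (a y).
rewrite -addn1 leq_add2l -has_count; apply/hasP; exists x => //=.
by rewrite nax.
Qed.

(** * The term condition and sparse solutions *)

Section Algebras.
Variables (F : finType) (ar : F -> nat).

Fixpoint term_map (V W : Type) (h : V -> W) (t : term ar V) : term ar W :=
  match t with
  | TVar v => TVar ar (h v)
  | TApp f args => TApp (fun i => term_map h (args i))
  end.

Lemma eval_term_map (B : Type) (op : forall f : F, ('I_(ar f) -> B) -> B)
    (V W : Type) (h : V -> W) (env : W -> B) (t : term ar V) :
  eval op env (term_map h t) = eval op (fun v => env (h v)) t.
Proof.
elim: t => //= f args IH; congr op.
exact: functional_extensionality.
Qed.

(** A cube whose other edges are equalities meets the premise for every centralizing [delta] by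
    reflexivity. Its top edge thus lies in all these congruences, that is, in the commutator, which
    is equality. *)
Lemma supernilpotent_centralizes (B : algebra ar) k :
  k_supernilpotent B k -> @centralizes F ar B k (fun _ _ _ => True) eq.
Proof.
move=> HB m p a b _ pe Hpe; apply/HB => delta [refl _ _ _] cent.
by apply: cent => // s /Hpe; rewrite /pe => ->.
Qed.

Variables (T : finType) (ops : forall f : F, ('I_(ar f) -> T) -> T) (z : T).

Definition poly_eval (env : nat -> T) (t : term ar (nat + T)) : T :=
  eval ops (fun v => match v with inl x => env x | inr c => c end) t.

Lemma supernilpotent_zero_out k : k_supernilpotent (Algebra ops) k ->
  exists N, forall (t1 t2 : term ar (nat + T)) (env : nat -> T) (xs : seq nat),
    uniq xs -> N <= size xs ->
    exists env' : nat -> T,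
      [/\ forall x, env' x = env x \/ env' x = z,
          exists2 x, x \in xs & env' x = z,
          poly_eval env' t1 = poly_eval env t1 &
          poly_eval env' t2 = poly_eval env t2].
Proof.
move=> /supernilpotent_centralizes cent.
have [N HN] := invisible_block k (T * T)%type; exists N => t1 t2 env xs xs_uniq le_N.
pose killed (P : nat -> bool) x := [&& x \in xs, index x xs < N & P (index x xs)].
pose kill P x := if killed P x then z else env x.
have kill_local P Q : (forall i, i < N -> P i = Q i) -> kill P = kill Q.
  move=> PQ; apply: functional_extensionality => x; rewrite /kill /killed.
  by case: (ltnP (index x xs) N) => [/PQ ->|] //.
pose g P := (poly_eval (kill P) t1, poly_eval (kill P) t2).
have g_local : local_below N g by move=> P Q PQ; rewrite /g (kill_local _ _ PQ).
have [phi [[y lt_y Ey] phiP]] := HN g g_local.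
(* The labels reset to [z] at the vertex [(s, e)] of the cube: a false bit resets its block. Block 0
   belongs to the last direction, with bit [e]. *)
pose off (s : 'I_k -> bool) (e : bool) (l : nat) :=
  if l is l'.+1 then (if insub l' is Some j then ~~ s j else false) else ~~ e.
have off_k s e i : k < i -> ~~ off s e i.
  by case: i => // i lt_i; rewrite /off insubF //; lia.
have off_g (s : 'I_k -> bool) : ~ (forall j, s j) ->
    g (fun x => off s false (phi x)) = g (fun x => off s true (phi x)).
  (* Block [j.+1] is reset since [s j] is false, so the union is nonempty and block 0 is
     invisible. *)
  move=> /forallP; rewrite negb_forall => /existsP[j nsj].
  rewrite [RHS]phiP //; last by move=> i; apply: off_k.
    by apply: g_local => x _; case: (phi x).
  exists j.+1; first by rewrite /= ltn_ord.
  by rewrite /off valK.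
(* Each direction gets [N] coordinates for uniformity; [var] uses only those whose index lies in the
   block of that direction, and other variables become constants. *)
pose m (_ : 'I_k.+1) := N.
pose var x : {i : 'I_k.+1 & 'I_(m i)} + T :=
  if (insub (index x xs) : option 'I_N) is Some i then
    if x \notin xs then inr (env x) else
    if phi i is l.+1 then
      if (insub l : option 'I_k) is Some j then inl (existT (fun i => 'I_(m i)) (lift ord_max j : 'I_k.+1) i)
      else inr (env x)
    else inl (existT (fun i => 'I_(m i)) (ord_max : 'I_k.+1) i)
  else inr (env x).
pose a (i : 'I_k.+1) (j : 'I_(m i)) := z.
pose b (i : 'I_k.+1) (j : 'I_(m i)) := env (nth 0 xs j).
pose sub v := match v with inl x => var x | inr c => inr c end.
pose val_at s e (v : {i : 'I_k.+1 & 'I_(m i)} + T) := match v with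
  | inl x => (if sel s e (tag x) then b else a) (tag x) (tagged x)
  | inr c => c end.
have pe_kill s e t : eval ops (val_at s e) (term_map sub t) =
    poly_eval (kill (fun x => off s e (phi x))) t.
  rewrite eval_term_map /poly_eval; congr eval; apply: functional_extensionality => -[x|c] //=.
  rewrite /kill /killed /var; case: insubP => [i lt_i Ei|/negbTE ->]; last by rewrite andbF.
  rewrite -Ei ltn_ord; case: (boolP (x \in xs)) => //= x_xs.
  have Ex : nth 0 xs i = x by rewrite Ei nth_index.
  case: (phi i) => [|l] /=.
    by rewrite /sel unlift_none; case: e; rewrite //= /b Ex.
  case: insubP => [j _ _|_] //=.
  by rewrite /sel liftK; case: (s j); rewrite //= /b Ex.
(* On the top edge only block 0 moves: one end resets it, the other is [env]. *)
have top t (pr : T * T -> T) : (forall P, poly_eval (kill P) t = pr (g P)) ->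
    poly_eval (kill (fun x => off (fun _ => true) false (phi x))) t = poly_eval env t.
  move=> Hpr; have := cent m (term_map sub t) a b (fun _ _ => I); rewrite /= -/val_at.
  rewrite !pe_kill => ->; last by move=> s /off_g Hs; rewrite !pe_kill !Hpr Hs.
  congr poly_eval; apply: functional_extensionality => x; rewrite /kill /killed /off.
  by case: (phi _) => [|l]; [|case: insub => [j|]]; rewrite !andbF.
exists (kill (fun x => off (fun _ => true) false (phi x))); split.
- by move=> x; rewrite /kill; case: ifP; [right|left].
- exists (nth 0 xs y); first by rewrite mem_nth // (leq_trans lt_y).
  have lt_y' := leq_trans lt_y le_N.
  by rewrite /kill /killed mem_nth // index_uniq // lt_y Ey.
- exact: (top t1 fst).
- exact: (top t2 snd).
Qed.

(** Descent on the number of coordinates different from [z]: while it exceeds [N], resetting a block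
    lowers it and keeps both values. *)
Lemma supernilpotent_sparse_solution : supernilpotent (Algebra ops) ->
  exists N, forall (t1 t2 : term ar (nat + T)) (env : nat -> T) n,
    poly_eval env t1 = poly_eval env t2 ->
    (forall x, n <= x -> env x = z) ->
    exists env' : nat -> T,
      [/\ poly_eval env' t1 = poly_eval env' t2, (forall x, n <= x -> env' x = z) &
          count (fun x => env' x != z) (iota 0 n) <= N].
Proof.
move=> [k [_ /supernilpotent_zero_out[N HN]]]; exists N => t1 t2 env n.
have [c] := ubnP (count (fun x => env x != z) (iota 0 n)).
elim: c env => // c IH env; rewrite ltnS => le_c Heq Hn.
have [le_N|lt_N] := leqP (count (fun x => env x != z) (iota 0 n)) N; first by exists env.
pose xs := [seq x <- iota 0 n | env x != z].
have [||env' [Henv' [x x_xs Ex] E1 E2]] := HN t1 t2 env xs.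
- by rewrite filter_uniq ?iota_uniq.
- by rewrite size_filter ltnW.
have zero_out y : env y = z -> env' y = z by case: (Henv' y) => ->.
apply: (IH env'); rewrite ?E1 ?E2 //; last by move=> y /Hn/zero_out.
move: x_xs; rewrite mem_filter => /andP[nz_x x_in]; apply: leq_trans le_c.
apply: count_ltn x_in nz_x _; last by rewrite Ex eqxx.
by move=> y; apply: contra => /eqP/zero_out ->.
Qed.

(** Unfolding a circuit into terms may blow up its size; this is harmless, since the terms only
    serve to prove that a sparse solution exists. *)
Lemma gate_terms (gs : seq (gate ar T)) : gates_wf gs ->
  exists ts : nat -> term ar (nat + T), forall env i, i < size gs ->
    nth z (gate_vals ops env gs) i = poly_eval env (ts i).
Proof.
elim/last_ind: gs => [_|gs g IH /gates_wf_rcons[/IH[ts Hts] Hg]].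
  by exists (fun _ => TVar ar (inr z)).
pose t := match g with
  | GVar x => TVar ar (inl x)
  | GConst c => TVar ar (inr c)
  | GOp f args => TApp (fun j => ts (args j))
  end.
exists (fun i => if i == size gs then t else ts i) => env i.
rewrite size_rcons gate_vals_rcons nth_rcons size_gate_vals ltnS.
case: ltngtP => // [lt_i _|_ _]; first exact: Hts.
rewrite {}/t; case: g Hg => //= f args /forallP Hargs.
rewrite /poly_eval /=; congr ops; apply: functional_extensionality => j.
by rewrite -/(poly_eval _ _) -Hts //; apply: set_nth_default; rewrite size_gate_vals.
Qed.

(** In unary, an occurrence of variable [x] takes more than [x] symbols. So the tape has a cell for
    every variable that occurs. *)
Lemma gate_vals_local (gs : seq (gate ar T)) env env' : gates_wf gs ->
    (forall x, x < size (flatten (map (@enc_gate F ar T) gs)) -> env x = env' x) ->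
  gate_vals ops env gs = gate_vals ops env' gs.
Proof.
elim/last_ind: gs => // gs g IH /gates_wf_rcons[Hgs Hg] Henv.
rewrite !gate_vals_rcons -IH // => [|x lt_x]; last first.
  by apply: Henv; rewrite map_rcons flatten_rcons size_cat ltn_addr.
congr rcons; case: g Hg Henv => //= [x _|f args /forallP Hargs] Henv.
  apply: Henv; rewrite map_rcons flatten_rcons size_cat /= size_rcons size_nseq; lia.
congr ops; apply: functional_extensionality => j.
by apply: set_nth_default; rewrite size_gate_vals.
Qed.

(** * Finding a sparse solution by nested searches *)

Local Notation sym := (sym F T).

Definition set_value (v : T) (xe : sym * T) : sym * T := (xe.1, v).

Definition alter_values (vs : seq T) (L : seq (sym * T) -> Prop) :=
  foldr (fun v => alter_closure (set_value v)) L vs.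

Lemma sweep_decidable_alter_values vs L :
  sweep_decidable L -> sweep_decidable (alter_values vs L).
Proof. by move=> HL; elim: vs => //= v vs; apply: sweep_decidable_alter. Qed.

Lemma map_fst_alter v p w : map fst (alter (set_value v) p w) = map fst w.
Proof. by rewrite /alter; elim: w 0 => //= x w IH k; rewrite IH; case: ifP. Qed.

Lemma alter_values_elim vs L w :
  alter_values vs L w -> exists2 w', map fst w' = map fst w & L w'.
Proof.
elim: vs w => [|v vs IH] w /=; first by exists w.
by move=> [p /IH[w' Ew' Lw']]; exists w'; rewrite // Ew' map_fst_alter.
Qed.

Lemma alter_values_id vs (L : seq (sym * T) -> Prop) w : L w -> alter_values vs L w.
Proof.
by move=> Lw; elim: vs => //= v vs IH; exists (size w); rewrite alter_default.
Qed.

Lemma alter_values_one vs (L : seq (sym * T) -> Prop) w v p :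
  v \in vs -> L (alter (set_value v) p w) -> alter_values vs L w.
Proof.
elim: vs => //= v' vs IH; rewrite inE; case: eqP => [<- _|_ /= v_vs] Lw.
  by exists p; apply: alter_values_id.
by exists (size w); rewrite alter_default //; apply: IH.
Qed.

(** Each of the [N] rounds offers every value of [T] once and so can correct one wrong cell; the
    unwanted alterations of the round are placed past the end. *)
Lemma alter_values_sparse (L : seq (sym * T) -> Prop) (env : nat -> T) N w :
    L (zip (map fst w) (mkseq env (size w))) ->
    count (fun i => nth z (map snd w) i != env i) (iota 0 (size w)) <= N ->
  alter_values (flatten (nseq N (enum T))) L w.
Proof.
have same (u : seq (sym * T)) : zip (map fst u) (mkseq env (size u)) = u \/
    has (fun i => nth z (map snd u) i != env i) (iota 0 (size u)).
  case: hasP => [|same]; [by right|left].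
  rewrite -[RHS]zip_unzip; congr zip; apply: (@eq_from_nth _ z) => [|i].
    by rewrite size_mkseq size_map.
  rewrite size_mkseq => lt_i; rewrite nth_mkseq //; apply/eqP; case: eqP => // ne.
  by case: same; exists i; [rewrite mem_iota|apply/eqP => E; case: ne].
elim: N w => [|N IH] w Lw le_N.
  by case: (same w) Lw => [->|] //; rewrite has_count ltnNge le_N.
case: (same w) => [Ew|/hasP[p]]; first by rewrite Ew in Lw; apply: alter_values_id.
rewrite mem_iota /= => lt_p ne_p.
rewrite /alter_values foldr_cat; apply: (@alter_values_one _ _ _ (env p) p).
  by rewrite mem_enum.
have nth_snd i : i < size w -> nth z (map snd (alter (set_value (env p)) p w)) i =
    if i == p then env p else nth z (map snd w) i.
  move=> lt_i; rewrite !(nth_map (s_one F T, z)) ?size_alter // nth_alter //.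
  by case: ifP.
apply: IH; first by rewrite map_fst_alter size_alter.
rewrite size_alter -ltnS; apply: leq_trans le_N.
rewrite (@eq_in_count _ _ (fun i => (i != p) && (nth z (map snd w) i != env i))).
  apply: (@count_ltn _ _ _ _ p) => //=; rewrite ?mem_iota ?eqxx //.
  by move=> i /andP[].
move=> i; rewrite mem_iota => /nth_snd ->.
by case: (eqVneq i p) => [->|]; rewrite ?eqxx.
Qed.

Lemma supernilpotent_pointed_CSAT_in_P : supernilpotent (Algebra ops) -> CSAT_in_P ops.
Proof.
move=> /supernilpotent_sparse_solution[N HN]; apply: sweep_decidable_in_P.
have [M [k HM]] := sweep_decidable_map (fun x : sym => (x, z))
  (sweep_decidable_alter_values (flatten (nseq N (enum T))) (evaluator_decidable ops z)).
exists M, k => w; have [b Hb HL] := HM w; exists b => //; rewrite {}HL {M k HM b Hb}.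
split=> [/alter_values_elim[w' Ew' /evaluator_accepts[c [c_wf Ec Eout]]]|].
  exists c; split=> //; split; first by rewrite Ec Ew' -map_comp map_id.
  exists (nth z (map snd w')).
  have /circuit_wfP[_ lt1 lt2] := c_wf.
  by rewrite -!(@set_nth_default _ _ _ z) // size_gate_vals.
move=> [c [c_wf [Ec [env Eout]]]]; have /circuit_wfP[gs_wf lt1 lt2] := c_wf.
(* Variables from [size w] on do not occur in [c], so they may be set to [z]. *)
pose env0 x := if x < size w then env x else z.
have [ts Hts] := gate_terms gs_wf.
have E0 : node_vals ops env c = gate_vals ops env0 (gates c).
  apply: gate_vals_local => // x lt_x; rewrite /env0 -Ec size_cat ltn_addr //.
have [||env' [Eout' env'_z sparse]] := HN (ts (out1 c)) (ts (out2 c)) env0 (size w).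
- rewrite E0 in Eout.
  by rewrite -!Hts // -!(@set_nth_default _ _ z (env 0)) ?size_gate_vals.
- by move=> x; rewrite /env0 ltnNge => ->.
apply: (@alter_values_sparse _ env'); last first.
  rewrite size_map; apply: leq_trans sparse; apply: eq_leq; apply: eq_in_count => i.
  by rewrite mem_iota => lt_i; rewrite -map_comp (nth_map (s_one F T)) // eq_sym.
set ws := zip _ _.
have Ews : map fst ws = w.
  by rewrite -/(unzip1 _) unzip1_zip -?map_comp ?map_id // size_mkseq !size_map.
have Eenv : nth z (map snd ws) = env'.
  apply: functional_extensionality => x.
  rewrite -/(unzip2 _) unzip2_zip ?size_mkseq ?size_map //.
  have [lt_x|le_x] := ltnP x (size w); first by rewrite nth_mkseq.
  by rewrite nth_default ?env'_z // size_mkseq.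
apply/evaluator_accepts; rewrite Ews Eenv; exists c; split=> //.
by rewrite [LHS]Hts // [RHS]Hts.
Qed.

End Algebras.

Theorem theorem9p4 (F : finType) (ar : F -> nat) (T : finType)
    (ops : forall f : F, ('I_(ar f) -> T) -> T) :
  supernilpotent (Algebra ops) ->
  congruence_modular_variety (Algebra ops) ->
  CSAT_in_P ops.
Proof.
(* The search needs a base point [z]. If [T] is empty there is no assignment, and a machine
   rejecting every word is correct. *)
move=> HA _; case: (pickP (predT : pred T)) => [z _|T0].
  exact: (supernilpotent_pointed_CSAT_in_P z HA).
apply: sweep_decidable_in_P.
exists (@Sweeper _ unit unit (fun _ => tt) tt (fun _ _ => (tt, tt)) (fun _ => inr false)), 0.
move=> w; exists false; first by rewrite expn0 /=; case: sweep.
by split=> // -[c [_ [_ [env _]]]]; have := T0 (env 0).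
Qed.
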